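(* Let $m\ge 2$, $n\ge 1$ and let $\mathcal{A}=(a_{i_1\cdots i_m})\in T_{m,n}$ be an R-tensor. Then $\mathcal{A}$ is a Q-tensor; that is, the tensor complementarity problem $(\mathbf{q},\mathcal{A})$ has a solution for all $\mathbf{q}\in\mathbb{R}^n$.
   Context: $T_{m,n}$ is the set of real $m$th order $n$-dimensional tensors $\mathcal{A}=(a_{i_1\cdots i_m})$, with real entries indexed by $i_1,\ldots,i_m\in I_n:=\{1,\ldots,n\}$ (no symmetry assumed). For $\mathbf{x}\in\mathbb{R}^n$, $\mathcal{A}\mathbf{x}^{m-1}\in\mathbb{R}^n$ is the vector with components $(\mathcal{A}\mathbf{x}^{m-1})_i=\sum_{i_2,\ldots,i_m=1}^n a_{ii_2\cdots i_m}x_{i_2}\cdots x_{i_m}$. Vector inequalities are componentwise. Tensor complementarity problem $(\mathbf{q},\mathcal{A})$, for $\mathbf{q}\in\mathbb{R}^n$: find $\mathbf{x}\in\mathbb{R}^n$ such that $\mathbf{x}\ge\mathbf{0}$, $\mathbf{q}+\mathcal{A}\mathbf{x}^{m-1}\ge\mathbf{0}$ and $\mathbf{x}^\top(\mathbf{q}+\mathcal{A}\mathbf{x}^{m-1})=0$. $\mathcal{A}$ is a Q-tensor iff $(\mathbf{q},\mathcal{A})$ has a solution for every $\mathbf{q}\in\mathbb{R}^n$. $\mathcal{A}$ is an R-tensor iff there are no $\mathbf{x}\in\mathbb{R}^n$ and $t\in\mathbb{R}$ with $\mathbf{0}\neq\mathbf{x}\ge\mathbf{0}$, $t\ge 0$,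 such that $(\mathcal{A}\mathbf{x}^{m-1})_i+t=0$ for every $i$ with $x_i>0$ and $(\mathcal{A}\mathbf{x}^{m-1})_j+t\ge 0$ for every $j$ with $x_j=0$. *)

(* Defs.v *)
From mathcomp Require Import all_boot all_order all_algebra reals.

Set Implicit Arguments.
Unset Strict Implicit.
Unset Printing Implicit Defensive.

Import Order.TTheory GRing.Theory Num.Theory.
Local Open Scope ring_scope.

Definition tensor (R : realType) (m n : nat) := {ffun m.-tuple 'I_n -> R}.

(* For m >= 1 the m-tuples of indices with head i are exactly the
   (i, i_2, ..., i_m), so component i is the sum over i_2, ..., i_m of
   a_(i i_2 ... i_m) x_(i_2) ... x_(i_m); see tapplyE. *)
Definition tapply (R : realType) (m n : nat) (A : tensor R m n) (x : 'cV[R]_n)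
    : 'cV[R]_n :=
  \col_i \sum_(s : m.-tuple 'I_n | ohead s == Some i)
           A s * \prod_(j <- behead s) x j 0.

Lemma tapplyE (R : realType) (m n : nat) (A : tensor R m.+1 n) (x : 'cV[R]_n)
    (i : 'I_n) :
  tapply A x i 0 =
  \sum_(s : m.-tuple 'I_n) A [tuple of i :: s] * \prod_(k < m) x (tnth s k) 0.
Proof.
rewrite mxE (reindex_onto (fun s : m.-tuple 'I_n => [tuple of i :: s])
                          (fun s : m.+1.-tuple 'I_n => [tuple of behead s])) /=.
  apply: eq_big => [s|s _]; last by rewrite big_tuple.
  by rewrite eqxx /=; apply/eqP/val_inj.
by case/tupleP=> j s /= /eqP[->]; apply/val_inj.
Qed.

Definition vec_ge0 (R : realType) (n : nat) (v : 'cV[R]_n) : Prop :=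
  forall i, 0 <= v i 0.

Definition TCP_solution (R : realType) (m n : nat) (q : 'cV[R]_n)
    (A : tensor R m n) (x : 'cV[R]_n) : Prop :=
  [/\ vec_ge0 x, vec_ge0 (q + tapply A x) & x^T *m (q + tapply A x) = 0].

Definition Q_tensor (R : realType) (m n : nat) (A : tensor R m n) : Prop :=
  forall q : 'cV[R]_n, exists x : 'cV[R]_n, TCP_solution q A x.

Definition R_tensor (R : realType) (m n : nat) (A : tensor R m n) : Prop :=
  ~ exists (x : 'cV[R]_n) (t : R),
      [/\ x <> 0, vec_ge0 x, 0 <= t,
          (forall i, 0 < x i 0 -> tapply A x i 0 + t = 0)
        & (forall j, x j 0 = 0 -> 0 <= tapply A x j 0 + t)].

(* Main.v *)
(** For z = (s, x) in the simplex of R^(1+n), consider the continuous map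
    F(z) = (s^(m-1), A x^(m-1) + s^(m-1) (q + e)), with e the all-ones vector.
    There is a z such that F_i(z) = min_j F_j(z) whenever z_i > 0. If s = 0,
    then x and t = - min_j F_j(z) >= 0 contradict the R-tensor property; if
    s > 0, the minimum is s^(m-1) and x / s solves the complementarity problem.

    To find z, label each point of a fine grid on the simplex by an index
    minimising F. Scarf's lemma on dominating sets (proved by the parity count
    of doors and rooms) yields a cluster of nearby grid points that carries
    every label i whose coordinate is not small on it; any limit of such
    clusters is a solution. *)
Require Import Defs.
From mathcomp Require Import all_boot all_order all_algebra reals.
From mathcomp Require Import boolp classical_sets interval_inference.
From mathcomp Require Import topology normedtype realfun.
From mathcomp Require Import lra.
From mathcomp Require Import fintype finset.

Set Implicit Arguments.
Unset Strict Implicit.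
Unset Printing Implicit Defensive.

(** * Scarf's lemma by counting doors and rooms *)

(** Double counting of incidences between doors T and rooms S = y |: T. *)
Lemma sum_card_ins_del (Y : finType) (P Q : pred {set Y}) :
  \sum_(T : {set Y} | P T) #|[set y | (y \notin T) && Q (y |: T)]| =
  \sum_(S : {set Y} | Q S) #|[set y in S | P (S :\ y)]|.
Proof.
have E (B : {set Y}) : #|B| = \sum_(y in B) 1 by rewrite sum1_card.
under eq_bigr do rewrite E; under [RHS]eq_bigr do rewrite E.
rewrite (exchange_big_dep predT) //= [RHS](exchange_big_dep predT) //=.
apply: eq_bigr => y _.
rewrite (reindex_onto (fun S => S :\ y) (fun T => y |: T)) /=; last first.
  by move=> T /andP[_]; rewrite inE => /andP[yT _]; rewrite setU1K.
apply: eq_bigl => S; rewrite !inE eqxx /=.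
case: (boolP (y \in S)) => yS; first by rewrite setD1K // eqxx andbT andbC.
rewrite andbF; apply/negbTE/negP => /andP[_ /eqP eS].
by move: yS; rewrite -eS !inE eqxx.
Qed.

(* [s i] is a slack element: lowest for the order [r i], and above every
   non-slack element for the other orders. It encodes Scarf's cells, the pairs
   (S0, C) of a set of points and a set of colours: S stands for its non-slack
   part together with C = {i | s i \notin S}. Rooms are then the dominating
   sets of size #|I| and doors those of size #|I| - 1. *)
Section UniformScarf.
Variables (I Y : finType) (s : I -> Y) (r : I -> Y -> nat) (l : Y -> I).
Variables (x0 : Y) (i0 : I).
Hypothesis r_inj : forall i, injective (r i).
Hypothesis r_min : forall i y, r i (s i) <= r i y.
Hypothesis r_max : forall i j y, i != j -> y \notin codom s -> r i y < r i (s j).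
Hypothesis sK : cancel s l.
Hypothesis x0_s : x0 \notin codom s.

Definition dominating (S : {set Y}) :=
  [forall y, exists i, [forall x in S, r i y <= r i x]].

Lemma dominatingP (S : {set Y}) :
  reflect (forall y, exists i, forall x, x \in S -> r i y <= r i x)
          (dominating S).
Proof.
apply: (iffP forallP) => H y.
  by have /existsP[i /forall_inP Hi] := H y; exists i.
by have [i Hi] := H y; apply/existsP; exists i; apply/forall_inP.
Qed.

Lemma dominatingS (S T : {set Y}) : T \subset S -> dominating S -> dominating T.
Proof.
move=> TS /dominatingP H; apply/dominatingP => y.
by have [i Hi] := H y; exists i => x /(subsetP TS)/Hi.
Qed.

(* [T] has one element less than there are colours, so exactly two colours a, b
   share their minimiser on T; the two rooms over T arise by adding an element
   that becomes the new minimiser of a, respectively of b. *)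
Lemma internal_door (T : {set Y}) (x : Y) :
  #|T|.+1 = #|I| -> dominating T -> x \in T -> x \notin codom s ->
  #|[set y | (y \notin T) && dominating (y |: T)]| = 2.
Proof.
move=> cT /dominatingP dT xT xs.
pose mn i := [arg min_(z < x in T) r i z].
have mnT i : mn i \in T by rewrite /mn; case: arg_minnP.
have mn_le i z : z \in T -> r i (mn i) <= r i z.
  by rewrite /mn; case: arg_minnP => // ? _; apply.
have mnE i z : z \in T -> (forall y, y \in T -> r i z <= r i y) -> z = mn i.
  by move=> zT Hz; apply: (r_inj (i := i)); apply/eqP; rewrite eqn_leq mn_le // Hz.
have [a [b [ab mab]]] : exists a b, a != b /\ mn a = mn b.
  have : ~~ injectiveb mn.
    apply/negP => /injectiveP/card_codom cI.
    have : #|codom mn| <= #|T|.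
      by apply: subset_leq_card; apply/subsetP => _ /codomP[i ->].
    by rewrite cI -cT ltnn.
  by case/injectivePn => a [b]; exists a, b.
(* The minimisers exhaust T, so deleting one of a, b leaves a bijection onto T. *)
have mn_inj c d : c != d -> mn c = mn d -> {in predC1 c &, injective mn}.
  move=> cd mcd; apply/dinjectiveP; apply/card_uniqP.
  rewrite size_image; apply/eqP; rewrite eqn_leq.
  have -> : #|predC1 c| = #|T|.
    by apply/eqP; rewrite -eqSS cT cardC1 prednK //; apply/card_gt0P; exists c.
  apply/andP; split; apply: subset_leq_card; apply/subsetP => z.
    by case/imageP => i _ ->.
  move=> zT; have [i Hi] := dT z; rewrite (mnE i z zT Hi).
  case: (eqVneq i c) => [->|ic]; last by apply: image_f.
  by rewrite mcd; apply: image_f; rewrite inE eq_sym.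
(* Adding an element of [M c] can change no minimiser but that of c; [yy c] is the highest such
   element for [r c]. *)
pose M c := [pred y | [forall (i | i != c), r i (mn i) < r i y]].
have sM c : M c (s c).
  apply/forall_inP => i ic; apply: leq_ltn_trans (mn_le i x xT) _.
  exact: r_max.
pose yy c := [arg max_(z > s c | M c z) r c z].
have yyM c : M c (yy c) by rewrite /yy; case: arg_maxnP.
have yy_max c z : M c z -> r c z <= r c (yy c).
  by rewrite /yy; case: arg_maxnP => // ? _; apply.
have ltM c y : M c y -> r c y <= r c (mn c).
  move=> /forall_inP My; have [i Hi] := dT y.
  case: (eqVneq i c) => [<-|ic]; first exact: Hi.
  by have := My i ic; rewrite ltnNge Hi.
have MT c d y : c != d -> mn c = mn d -> M c y -> y \notin T.
  move=> cd mcd /forall_inP My; apply/negP => yT; have [i Hi] := dT y.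
  have E := mnE i y yT Hi; move: (My i); rewrite -E ltnn.
  case: (eqVneq i c) => [ic _|_ /(_ isT)//].
  by have := My d; rewrite eq_sym cd -mcd -ic -E ltnn => /(_ isT).
have yy_ok c d : c != d -> mn c = mn d -> dominating (yy c |: T).
  move=> cd mcd; apply/dominatingP => z.
  have [Mz|] := boolP (M c z).
    exists c => w /setU1P[->|wT]; first exact: yy_max.
    exact: leq_trans (ltM _ _ Mz) (mn_le _ _ wT).
  case/forall_inPn => i ic; rewrite -leqNgt => zi; exists i => w.
  case/setU1P => [->|wT]; last exact: leq_trans zi (mn_le _ _ wT).
  by apply: leq_trans zi (ltnW _); move/forall_inP: (yyM c); apply.
(* A common value would exceed the minimum of every colour, so no colour could dominate it. *)
have yyab : yy a != yy b.
  apply/eqP => E; have [i Hi] := dT (yy a).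
  have := Hi _ (mnT i); rewrite leqNgt; case/negP.
  case: (eqVneq i a) => [ia|ia]; last by move/forall_inP: (yyM a); apply.
  by rewrite E; move/forall_inP: (yyM b); apply; rewrite ia.
suff -> : [set y | (y \notin T) && dominating (y |: T)] = [set yy a; yy b].
  by rewrite cards2 yyab.
apply/setP => y; rewrite !inE; apply/andP/orP; last first.
  case=> /eqP ->; split.
  - exact: MT ab mab (yyM a).
  - exact: yy_ok ab mab.
  - by apply: MT (yyM b); [rewrite eq_sym; exact: ab | ].
  - by apply: (@yy_ok b a) => //; rewrite eq_sym.
case=> yT /dominatingP dY.
(* A y that becomes the minimum of c lies in [M c], and [yy c] can be dominated only through c;
   maximality of [yy c] then gives equality. *)
have key c d : c != d -> mn c = mn d ->
    (forall z, z \in y |: T -> r c y <= r c z) -> y = yy c.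
  move=> cd mcd Hc.
  have My : M c y.
    apply/forall_inP => i ic; rewrite ltnNge; apply/negP => yi.
    (* The index j dominating [mn i] shares its minimiser, so it must be c, where y would coincide
       with [mn c]. *)
    have [j Hj] := dY (mn i).
    have mij : mn i = mn j.
      by apply: mnE => // z zT; apply: Hj; rewrite inE zT orbT.
    have yj : r j (mn j) <= r j y by rewrite -mij; apply: Hj; rewrite setU11.
    have ij : i != j.
      apply: contra yT => /eqP eij; have : r i (mn i) = r i y.
        by apply/eqP; rewrite eqn_leq yi andbT eij yj.
      by move/r_inj <-.
    have jc : j = c.
      apply/eqP/negPn/negP => jc; case/eqP: ij.
      exact: (mn_inj c d cd mcd).
    have : r c (mn c) = r c y.
      apply/eqP; rewrite eqn_leq -{1 2 3}jc yj /=.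
      by apply: Hc; rewrite inE mnT orbT.
    by move/r_inj => E; case/negP: yT; rewrite -E mnT.
  have [i Hi] := dY (yy c).
  apply: (r_inj (i := c)); apply/eqP; rewrite eqn_leq yy_max //=.
  case: (eqVneq i c) => [ic|ic]; first by have := Hi y (setU11 _ _); rewrite ic.
  have /forall_inP/(_ i ic) := yyM c; rewrite ltnNge.
  by rewrite Hi // inE mnT orbT.
have [i Hi] := dY y.
have ri z : z \in T -> r i y < r i z.
  move=> zT; rewrite ltn_neqAle Hi ?inE ?zT ?orbT // andbT.
  by apply: contra yT => /eqP/r_inj ->.
case: (eqVneq i a) => [ia|ia].
  by rewrite ia in Hi; left; rewrite (key a b ab mab Hi).
case: (eqVneq i b) => [ib|ib].
  by rewrite ib in Hi; right; rewrite (key b a _ (esym mab) Hi) // eq_sym.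
(* Otherwise y takes over the only index whose minimiser is [mn i]. *)
have [j Hj] := dY (mn i).
have mij : mn i = mn j.
  by apply: mnE => // z zT; apply: Hj; rewrite inE zT orbT.
have ij : i != j.
  apply/eqP => eij; have := Hj y (setU11 _ _); rewrite -eij leqNgt.
  by rewrite ri.
have := mn_inj a b ab mab i j; rewrite !inE ia.
case: (eqVneq j a) => [ja _|_ /(_ isT isT mij)/eqP]; last by rewrite (negbTE ij).
have := mn_inj b a; rewrite eq_sym => /(_ ab (esym mab) i j).
by rewrite !inE ib ja ab -ja => /(_ isT isT mij)/eqP; rewrite (negbTE ij).
Qed.

(** A non-slack z can be dominated here only through i0: for any other i the set contains the lowest
    element [s i]. So the added element is the non-slack one highest for [r i0]. *)
Lemma outer_door :
  #|[set y | (y \notin s @: [set~ i0]) && dominating (y |: s @: [set~ i0])]| = 1.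
Proof.
pose y0 := [arg max_(z > x0 | z \notin codom s) r i0 z].
have y0s : y0 \notin codom s by rewrite /y0; case: arg_maxnP.
have y0_max z : z \notin codom s -> r i0 z <= r i0 y0.
  by rewrite /y0; case: arg_maxnP => // ? _; apply.
have r_ns i z : z \notin codom s -> ~ r i z <= r i (s i).
  move=> zs le; case/negP: zs; apply/codomP; exists i; apply: (r_inj (i := i)).
  by apply/eqP; rewrite eqn_leq le r_min.
suff -> : [set y | (y \notin s @: [set~ i0]) &&
                   dominating (y |: s @: [set~ i0])] = [set y0] by rewrite cards1.
apply/setP => y; rewrite !inE; apply/andP/eqP => [[ys /dominatingP dy]|->].
  have i0y z : z \notin codom s ->
      forall x, x \in y |: s @: [set~ i0] -> r i0 z <= r i0 x.
    move=> zs; have [i Hi] := dy z.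
    case: (eqVneq i i0) => [ii0|ii0]; first by rewrite ii0 in Hi.
    case: (r_ns i z zs); apply: Hi; apply/setU1P; right; apply: imset_f.
    by rewrite !inE.
  have y_s : y \notin codom s.
    apply/negP => /codomP[i yi]; case: (eqVneq i i0) => [ii0|ii0].
      by case: (r_ns i0 _ x0_s); move: yi; rewrite ii0 => <-; apply: i0y => //;
        rewrite setU11.
    by case/negP: ys; rewrite yi; apply: imset_f; rewrite !inE.
  apply: (r_inj (i := i0)); apply/eqP; rewrite eqn_leq y0_max //=.
  by apply: i0y => //;
        rewrite setU11.
split; first by apply: contra y0s => /imsetP[i _ ->]; exact: codom_f.
apply/dominatingP => z; have [/codomP[i ->]|zs] := boolP (z \in codom s).
  by exists i => x _; exact: r_min.
exists i0 => x /setU1P[->|/imsetP[i]]; first exact: y0_max.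
by rewrite !inE => ii0 ->; apply/ltnW/r_max => //; rewrite eq_sym.
Qed.

(** If removing y leaves exactly the colours other than i0, each occurs once there, so [l y] repeats
    the colour of a single z. Only y and z can be removed, hence the count is 0 or 2. *)
Lemma noncolourful_room (S : {set Y}) (P : pred {set Y}) :
  #|S| = #|I| -> l @: S != [set: I] ->
  (forall y, y \in S -> P (S :\ y) = (l @: (S :\ y) == [set~ i0])) ->
  ~~ odd #|[set y in S | P (S :\ y)]|.
Proof.
move=> cS nS PE.
have [->|[y]] := set_0Vmem [set y in S | P (S :\ y)]; first by rewrite cards0.
rewrite inE => /andP[yS]; rewrite PE // => /eqP ly.
have l_inj : {in S :\ y &, injective l}.
  apply/imset_injP; rewrite ly cardsC1 -cS (cardsD1 y S) yS //.
have lS z : z \in S -> l @: S = l z |: l @: (S :\ z).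
  by move=> zS; rewrite -{1}(setD1K zS) imsetU1.
have lyi0 : l y != i0.
  apply: contra nS => /eqP lyi; rewrite (lS y yS) ly lyi.
  by apply/eqP/setP => i; rewrite !inE orbN.
have lSE : l @: S = [set~ i0].
  by rewrite (lS y yS) ly; apply/setUidPr; rewrite sub1set !inE.
have : l y \in l @: (S :\ y) by rewrite ly !inE.
case/imsetP => z; rewrite !inE => /andP[zy zS] lyz.
suff -> : [set y in S | P (S :\ y)] = [set y; z].
  by rewrite cards2 eq_sym zy.
apply/setP => w; rewrite !inE; apply/andP/orP => [[wS]|].
  rewrite PE // => /eqP lw; have : l w \in l @: (S :\ w).
    by rewrite lw -lSE; exact: imset_f.
  case/imsetP => v; rewrite !inE => /andP[vw vS] lwv.
  case: (eqVneq w y) => [|wy]; [by left|right].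
  have [vy|vy] := eqVneq v y.
    by apply/eqP/l_inj; rewrite ?inE ?wy ?wS ?zy ?zS // lwv vy.
  by case/eqP: vw; apply: l_inj; rewrite ?inE ?wy ?wS ?vy ?vS.
case=> /eqP ->; split=> //; rewrite PE //; first by rewrite ly.
rewrite -lSE (lS z zS); apply/eqP/esym/setUidPr; rewrite sub1set -lyz.
by apply: imset_f; rewrite !inE eq_sym zy.
Qed.

(** The door [T0] lies in one room and every other door in two, so the number of incidences is odd;
    rooms missing a colour contribute evenly, so some room is colourful. *)
Lemma uniform_scarf : exists S : {set Y}, dominating S /\ l @: S = [set: I].
Proof.
pose door (T : {set Y}) := [&& #|T|.+1 == #|I|, dominating T & l @: T == [set~ i0]].
pose room (S : {set Y}) := (#|S| == #|I|) && dominating S.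
pose T0 := s @: [set~ i0].
have s_inj : injective s := can_inj sK.
have cT0 : #|T0|.+1 = #|I|.
  by rewrite card_imset // cardsC1 prednK //; apply/card_gt0P; exists i0.
have dT0 : door T0.
  have /card_gt0P[y] : 0 < #|[set y | (y \notin T0) && dominating (y |: T0)]|.
    by rewrite outer_door.
  rewrite inE => /andP[_ dy]; rewrite /door cT0 eqxx (dominatingS _ dy) ?subsetUr //=.
  by apply/eqP; rewrite -imset_comp -[RHS]imset_id; apply: eq_imset => i /=; rewrite sK.
have doorR (T : {set Y}) : door T -> [set y | (y \notin T) && room (y |: T)] =
    [set y | (y \notin T) && dominating (y |: T)].
  case/and3P => /eqP cT _ _; apply/setP => y; rewrite !inE /room.
  by case: (boolP (y \in T)) => //= yT; rewrite cardsU1 yT add1n cT eqxx.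
have := sum_card_ins_del door room.
rewrite (bigD1 T0) //= doorR // outer_door.
rewrite (eq_bigr (fun=> 2)) => [|T /andP[dT TT0]]; last first.
  rewrite doorR //; case/and3P: dT => /eqP cT dT /eqP lT.
  have [/existsP[x /andP[xT xs]]|] := boolP [exists x, (x \in T) && (x \notin codom s)].
    exact: internal_door xT xs.
  (* A door made of slack elements only has all labels but i0, so it is [T0]. *)
  rewrite negb_exists => /forallP Ts; case/eqP: TT0; apply/eqP.
  rewrite eqEcard -ltnS cT0 cT leqnn andbT; apply/subsetP => y yT.
  have := Ts y; rewrite yT /= negbK => /codomP[i yi]; rewrite yi; apply: imset_f.
  by rewrite -lT -(sK i) -yi imset_f.
rewrite sum_nat_const => E.
have [/existsP[S /andP[/andP[_ dS] /eqP lS]]|/existsPn nS] :=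
  boolP [exists S, room S && (l @: S == [set: I])]; first by exists S.
have : odd (\sum_(S | room S) #|[set y in S | door (S :\ y)]|).
  by rewrite -E oddD oddM andbF.
suff /negbTE -> : ~~ odd (\sum_(S | room S) #|[set y in S | door (S :\ y)]|) by [].
apply: (big_ind (fun n => ~~ odd n)) => // [p q|S rS].
  by rewrite oddD => /negbTE -> /negbTE ->.
have := nS S; rewrite rS /= => lS; case/andP: rS => /eqP cS dS.
apply: noncolourful_room => // y yS.
rewrite /door (dominatingS _ dS) ?subD1set //= -cS (cardsD1 y S) yS add1n eqxx //.
Qed.

End UniformScarf.

(* [w i] need not be injective: ties are broken by [enum_rank]. *)
Lemma scarf (I X : finType) (x0 : X) (i0 : I) (w : I -> X -> nat) (l : X -> I) :
  exists (C : {set I}) (p : I -> X),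
    (forall i, i \in C -> l (p i) = i) /\
    (forall y, exists2 i, i \in C & forall j, j \in C -> w i y <= w i (p j)).
Proof.
(* Division by [#|X|] recovers [w i]; the successor reserves 0 for the slack element of i. *)
pose v i (x : X) := (w i x * #|X| + enum_rank x).+1.
have v_lt (x : X) : enum_rank x < #|X| by exact: ltn_ord.
have v_mod i x : (v i x).-1 %% #|X| = enum_rank x by rewrite modnMDl modn_small //.
have v_div i x : (v i x).-1 %/ #|X| = w i x.
  by rewrite divnMDl ?divn_small ?addn0 //; apply/card_gt0P; exists x0.
pose B i := \max_x v i x.
have vB i x : v i x <= B i by exact: leq_bigmax.
pose r i (y : X + I) := match y with
  | inl x => v i x
  | inr j => if j == i then 0 else (B i + enum_rank j).+1 end.
have r_inj i : injective (r i).
  move=> [x|j] [x'|j'] /=.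
  - move=> E; congr inl; apply: enum_rank_inj; apply: val_inj => /=.
    by rewrite -(v_mod i x) E v_mod.
  - case: eqP => // _ E; have := vB i x; rewrite E.
    by rewrite ltnNge leq_addr.
  - case: eqP => // _ E; have := vB i x'; rewrite -E.
    by rewrite ltnNge leq_addr.
  - case: (eqVneq j i) => [->|_]; case: (eqVneq j' i) => [->|_] // [] /addnI E.
    by congr inr; apply: enum_rank_inj; exact: val_inj.
have r_min i y : r i (inr i) <= r i y by rewrite /= eqxx.
have notin_s x : inl x \notin codom (@inr X I) by apply/codomP => -[].
have r_max i j y : i != j -> y \notin codom (@inr X I) -> r i y < r i (inr j).
  case: y => [x|k]; last by rewrite codom_f.
  by rewrite /= eq_sym => /negbTE-> _; rewrite ltnS (leq_trans (vB i x)) ?leq_addr.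
pose l' (y : X + I) := match y with inl x => l x | inr j => j end.
have sK : cancel (@inr X I) l' by [].
have [S [/dominatingP dS lS]] :=
  uniform_scarf i0 r_inj r_min r_max sK (notin_s x0).
exists [set i | inr i \notin S].
(* As [l'] maps S onto all colours, a colour whose slack element is outside S labels some [inl x] in
   S; the default [x0] is never reached on such colours. *)
exists (fun i => odflt x0 [pick x | (inl x \in S) && (l x == i)]).
have pP i : inr i \notin S ->
    inl (odflt x0 [pick x | (inl x \in S) && (l x == i)]) \in S /\
    l (odflt x0 [pick x | (inl x \in S) && (l x == i)]) = i.
  move=> iS; case: pickP => [x /andP[? /eqP] //|] nx.
  have : i \in l' @: S by rewrite lS inE.
  case/imsetP => -[x|j] yS /= il; last by rewrite il yS in iS.
  by have := nx x; rewrite yS il eqxx.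
split=> [i|y]; first by rewrite inE => /pP[].
have [i Hi] := dS (inl y); exists i.
  by rewrite inE; apply/negP => /Hi; rewrite /= eqxx.
move=> j; rewrite inE => /pP[/Hi /= jS _].
by rewrite -(v_div i y) -[leqRHS](v_div i) leq_div2r // -ltnS.
Qed.

(** * Integer grid points on the simplex *)

(* If mu_i is the least i-th coordinate over the dominating set (0 for absent
   colours), no grid point exceeds mu on all colours present; hence mu sums to
   more than k - N.+1, and every chosen point is within N.+1 of mu. *)
Lemma grid_rainbow (N k : nat) (l : {ffun 'I_N.+1 -> nat} -> 'I_N.+1) :
  exists2 z : {ffun 'I_N.+1 -> nat}, \sum_i z i = k &
    forall i, z i <= N.+1 \/
      exists y : {ffun 'I_N.+1 -> nat}, [/\ \sum_i y i = k, l y = i &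
        forall j, y j <= z j + N.+1 /\ z j <= y j + N.+1].
Proof.
pose X := {x : {ffun 'I_N.+1 -> 'I_k.+1} | \sum_i x i == k}.
pose f (x : X) := [ffun i => val (val x i)].
have fk x : \sum_i f x i = k.
  by rewrite -[RHS](eqP (valP x)); apply: eq_bigr => i _; rewrite ffunE.
have f_onto (g : 'I_N.+1 -> nat) : \sum_i g i = k -> exists x, f x =1 g.
  move=> gk; have gle i : g i < k.+1 by rewrite ltnS -gk (bigD1 i) ?leq_addr.
  pose g' : {ffun _} := [ffun i => Ordinal (gle i)].
  have gP : \sum_i g' i == k.
    by rewrite -[X in _ == X]gk; apply/eqP/eq_bigr => i _; rewrite ffunE.
  by exists (Sub g' gP : X) => i; rewrite !ffunE.
have sum_pt i1 c : \sum_(i < N.+1) (if i == i1 then c else 0) = c.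
  by rewrite -big_mkcond big_pred1_eq.
have [x0 _] : exists x, f x =1 (fun i => if i == ord0 then k else 0).
  exact: f_onto.
have [C [p [lp dom]]] := scarf x0 ord0 (fun i x => f x i) (fun x => l (f x)).
have [i1 i1C _] := dom x0.
pose m i := [arg min_(j < i1 in C) f (p j) i].
pose mu i := if i \in C then f (p (m i)) i else 0.
have mu_le i j : j \in C -> mu i <= f (p j) i.
  rewrite /mu /m; case: ifP => // _ jC.
  by case: arg_minnP => // ? _; apply.
have mC i : m i \in C.
  by rewrite /m; case: arg_minnP.
have sum_mu : k < \sum_i mu i + N.+1.
  rewrite ltnNge; apply/negP => le_k.
  (* The surplus goes to i1 so that g sums to exactly k. *)
  pose g i := mu i + 1 + (if i == i1 then k - (\sum_i mu i + N.+1) else 0).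
  have [|x fx] := f_onto g.
    rewrite /g !big_split /= sum1_card card_ord sum_pt.
    by rewrite subnKC.
  have [i iC Hi] := dom x; have := Hi _ (mC i); rewrite fx /g /mu iC.
  by rewrite -addnA -[leqRHS]addn0 leq_add2l add1n.
have p_le i j : j \in C -> f (p j) i <= mu i + N.+1.
  move=> jC; rewrite -(leq_add2r (\sum_(i' | i' != i) mu i')) addnAC.
  rewrite -(bigD1 i (P := predT)) //=; apply: leq_trans (ltnW sum_mu).
  rewrite -[leqRHS](fk (p j)) [leqRHS](bigD1 i) //= leq_add2l.
  by apply: leq_sum => i2 _; exact: mu_le.
exists (f (p i1)) => // i; have [iC|iC] := boolP (i \in C); last first.
  by left; have := p_le i i1 i1C; rewrite /mu (negbTE iC).
right; exists (f (p i)); split => // [|j]; first exact: lp.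
by split; apply: leq_trans (p_le j _ _) _; rewrite ?leq_add2r ?mu_le.
Qed.

(** * Passage from the grid to the limit by compactness *)

Import Order.TTheory GRing.Theory Num.Theory.
Import numFieldNormedType.Exports.
Local Open Scope classical_set_scope.
Local Open Scope ring_scope.

Lemma simplex_approx (R : realType) (N k : nat) (F : 'I_N.+1 -> 'rV[R]_N.+1 -> R) :
  exists x : 'rV[R]_N.+1, [/\ forall i, 0 <= x 0 i, \sum_i x 0 i = 1 &
    forall i, x 0 i <= N.+1%:R / k.+1%:R \/
      exists y : 'rV[R]_N.+1, (forall j, F i y <= F j y) /\
        `|x - y| <= N.+1%:R / k.+1%:R].
Proof.
pose pt (g : {ffun 'I_N.+1 -> nat}) : 'rV[R]_N.+1 := \row_j ((g j)%:R / k.+1%:R).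
pose l g := [arg min_(i < ord0) F i (pt g)]%O.
have lP g j : F (l g) (pt g) <= F j (pt g).
  by rewrite /l; case: arg_minP => // i _; apply.
have k0 : 0 < k.+1%:R^-1 :> R by rewrite invr_gt0 ltr0n.
have [z sz zP] := grid_rainbow k.+1 l.
exists (pt z); split => [i||i].
- by rewrite mxE mulr_ge0 ?ler0n // ltW.
- under eq_bigr do rewrite mxE.
  by rewrite -mulr_suml -natr_sum sz divff // pnatr_eq0.
case: (zP i) => [zi|[y [_ ly yz]]].
  by left; rewrite mxE ler_pM2r // ler_nat.
right; exists (pt y); split; first by move=> j; rewrite -ly.
rewrite [leLHS]/Num.Def.normr /= mx_normrE; apply/bigmax_leP; split => [|[i' j] _ /=].
  by rewrite mulr_ge0 // ltW.
rewrite !mxE -mulrBl normrM (gtr0_norm k0) ler_pM2r // ler_distl.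
have [yz1 zy1] := yz j.
by rewrite lerBlDr -!natrD !ler_nat zy1 yz1.
Qed.

(** Take a cluster point x of the approximations. If F j < F i at x with x_i > 0, this persists on a
    ball, whereas a fine approximation near x has either a small coordinate i or a neighbour at
    which i minimises F. *)
Lemma simplex_vi (R : realType) (N : nat) (F : 'I_N.+1 -> 'rV[R]_N.+1 -> R) :
  (forall i, continuous (F i)) ->
  exists x : 'rV[R]_N.+1, [/\ forall i, 0 <= x 0 i, \sum_i x 0 i = 1 &
    forall i j, 0 < x 0 i -> F i x <= F j x].
Proof.
move=> Fc.
have [u uP] := choice (fun k => simplex_approx k F).
pose K := ([set v : 'rV[R]_N.+1 | forall i, `[0%R, 1%R]%classic (v ord0 i)] `&`
  (fun v : 'rV[R]_N.+1 => \sum_i v 0 i) @^-1` [set 1]).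
have Kc : compact K.
  apply: compact_closedI.
    apply: (@rV_compact R _ (fun=> `[0%R, 1%R]%classic)) => i; exact: segment_compact.
  apply: preimage_closed; last exact: closed_eq.
  move=> v _; apply: continuous_big; first exact: add_continuous.
  by move=> i _; exact: coord_continuous.
have uK : \forall k \near \oo, K (u k).
  near=> k; have [u0 u1 _] := uP k; split => //= i.
  rewrite in_itv /= u0 -u1 (bigD1 i) //= lerDl.
  by apply: sumr_ge0.
have [x [[x01 x1] xu]] := Kc (u @ \oo) _ uK.
have x0 i : 0 <= x 0 i by have := x01 i; rewrite /= in_itv /= => /andP[].
exists x; split => // i j xi; rewrite leNgt; apply/negP => Fji.
have : \forall y \near x, F j y < F i y.
  have c : continuous (fun y => F i y - F j y).
    by move=> y; apply: (@cvgB _ _ _ (nbhs y)); exact: Fc.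
  near=> y; rewrite -subr_gt0; near: y.
  by apply: (cvgr_gt (F i x - F j x)); [exact: c | rewrite subr_gt0].
case/nbhs_ballP => e /= e0 He.
(* One half of e pays for the distance from x to [u k], the other for the grid error; likewise for
   x_i. *)
pose d := Num.min (x 0 i / 2) (e / 2).
have d0 : 0 < d by rewrite lt_min !divr_gt0.
(* A cluster point yields a point of A, not an index, so A records an index with a fine enough
   grid. *)
pose A := [set v | exists2 k, v = u k & N.+1%:R / k.+1%:R < d].
have uA : \forall k \near \oo, A (u k).
  have d1 : 0 < d / N.+1%:R by rewrite divr_gt0.
  near=> k; exists k => //; rewrite mulrC -ltr_pdivlMr //.
  by near: k; exact: (near_infty_natSinv_lt (PosNum d1)).
have [_ [[k -> kd] ball_uk]] := xu A _ uA (nbhsx_ballx x d d0).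
have [_ _ /(_ i)] := uP k.
move: ball_uk; rewrite -ball_normE /= => xuk.
case=> [uki|[y [yF uky]]].
  have : `|x 0 i - u k 0 i| < d.
    apply: le_lt_trans xuk; rewrite [leRHS]/Num.Def.normr /= mx_normrE.
    apply/bigmax_geP; right => /=; exists (0, i) => //=.
    by rewrite !mxE.
  have : d <= x 0 i / 2 by rewrite ge_min lexx.
  have := le_lt_trans uki kd; have := ler_norm (x 0 i - u k 0 i).
  lra.
have /He : ball x e y.
  rewrite -ball_normE /=; have : d <= e / 2 by rewrite ge_min lexx orbT.
  have := le_lt_trans uky kd; have := ler_distD (u k) x y.
  lra.
by rewrite /= ltNge yF.
Unshelve. all: by end_near. Qed.

(** * The tensor map and the complementarity problem *)

Lemma tapplyZ (R : realType) (m n : nat) (A : tensor R m n) (c : R) (x : 'cV[R]_n) :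
  tapply A (c *: x) = c ^+ m.-1 *: tapply A x.
Proof.
apply/colP => i; rewrite !mxE mulr_sumr; apply: eq_bigr => s _.
rewrite mulrCA; congr (_ * _).
have -> : m.-1 = size (behead s) by rewrite size_behead size_tuple.
elim: (behead s) => [|j t IH] /=; first by rewrite !big_nil expr0 mulr1.
by rewrite !big_cons exprS mxE IH mulrACA.
Qed.

Lemma tapply_continuous (R : realType) (T : topologicalType) (m n : nat)
    (A : tensor R m n) (f : T -> 'cV[R]_n) (i : 'I_n) :
  (forall j, continuous (fun z => f z j 0)) ->
  continuous (fun z => tapply A (f z) i 0).
Proof.
move=> fc z; rewrite /continuous_at mxE.
under eq_cvg do rewrite mxE.
apply: cvg_big => [|s _]; first exact: add_continuous.
apply: cvgM; first exact: cvg_cst.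
by apply: cvg_big => [|j _]; [exact: mul_continuous | exact: fc].
Qed.

Theorem corollary3p2 (R : realType) (m n : nat) (hm : (2 <= m)%N) (hn : (1 <= n)%N)
    (A : tensor R m n) (hA : R_tensor A) : Q_tensor A.
Proof.
move=> q.
pose X (z : 'rV[R]_n.+1) : 'cV[R]_n := \col_i z 0 (lift ord0 i).
pose sig (z : 'rV[R]_n.+1) := z 0 ord0 ^+ m.-1.
pose F (i : 'I_n.+1) z := if unlift ord0 i is Some j
  then tapply A (X z) j 0 + sig z * (q j 0 + 1) else sig z.
have F0 z : F ord0 z = sig z by rewrite /F unlift_none.
have FS j z : F (lift ord0 j) z = tapply A (X z) j 0 + sig z * (q j 0 + 1).
  by rewrite /F liftK.
have sig_c : continuous sig.
  move=> z; apply: (@continuous_comp _ _ _ (fun z : 'rV[R]_n.+1 => z 0 ord0)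
                                            (fun t : R => t ^+ m.-1)).
    exact: coord_continuous.
  exact: exprn_continuous.
have Fc i : continuous (F i).
  rewrite /F; case: (unlift ord0 i) => [j|] //.
  move=> z; apply: (@cvgD _ _ _ (nbhs z)).
    apply: tapply_continuous => k y; rewrite /continuous_at mxE.
    by under eq_cvg do rewrite mxE; exact: coord_continuous.
  by apply: (@cvgM _ _ (nbhs z)); [exact: sig_c | exact: cvg_cst].
have [z [z0 z1 zF]] := simplex_vi Fc.
have X0 : vec_ge0 (X z) by move=> i; rewrite mxE.
(* As m >= 2, [sig] vanishes when the slack coordinate does. *)
have m0 : (0 < m.-1)%N by case: m hm {A hA sig F F0 FS sig_c Fc zF} => [|[|]].
have XE j : X z j 0 = z 0 (lift ord0 j) by rewrite mxE.
have := z0 ord0; rewrite le_eqVlt => /predU1P[s0|s_gt0].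
  (* The slack coordinate vanishes, so X z violates the R-tensor property. *)
  have sig0 : sig z = 0 by rewrite /sig -s0 expr0n -leqn0 leqNgt m0.
  case: hA.
  have [i zi] : exists i, 0 < z 0 (lift ord0 i).
    case: (pickP (fun i => 0 < z 0 (lift ord0 i))) => [i|H]; first by exists i.
    move: z1; rewrite big_ord_recl -s0 add0r big1 => [/eqP|i _].
      by rewrite eq_sym oner_eq0.
    by apply/eqP; rewrite eq_le z0 andbT leNgt H.
  (* Component i is the least one, and comparison with [F ord0 z], which is 0, gives t >= 0. *)
  pose t := - tapply A (X z) i 0.
  have Fle j k : 0 < X z j 0 -> tapply A (X z) j 0 <= tapply A (X z) k 0.
    by rewrite XE => /(zF _ (lift ord0 k)); rewrite !FS sig0 !mul0r !addr0.
  exists (X z), t; split => //.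
  - by move/colP/(_ i); rewrite XE mxE => E; rewrite E ltxx in zi.
  - have := zF _ ord0 zi; rewrite F0 FS sig0 mul0r addr0.
    by rewrite oppr_ge0.
  - move=> j xj; apply/eqP; rewrite subr_eq0 eq_le !Fle //.
    by rewrite XE.
  - by move=> j _; rewrite subr_ge0 Fle // XE.
have sig_gt0 : 0 < sig z by rewrite exprn_gt0.
(* The minimum [sig z] cancels the contribution of the all-ones vector. *)
have F_ge j : 0 <= tapply A (X z) j 0 + sig z * q j 0.
  by have := zF _ (lift ord0 j) s_gt0; rewrite F0 FS mulrDr mulr1 addrA lerDr.
have F_eq j : 0 < X z j 0 -> tapply A (X z) j 0 + sig z * q j 0 = 0.
  rewrite XE => /(zF _ ord0); rewrite F0 FS mulrDr mulr1 addrA gerDr => le0.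
  by apply/eqP; rewrite eq_le le0 F_ge.
pose c := (z 0 ord0)^-1.
have c_gt0 : 0 < c by rewrite invr_gt0.
(* Homogeneity, with c^(m-1) times [sig z] equal to 1. *)
have qE j : (q + tapply A (c *: X z)) j 0 =
    c ^+ m.-1 * (tapply A (X z) j 0 + sig z * q j 0).
  rewrite tapplyZ !mxE mulrDr mulrA -exprMn mulVf ?gt_eqF // expr1n mul1r.
  by rewrite addrC.
exists (c *: X z); split.
- by move=> j; rewrite mxE mulr_ge0 // ltW.
- by move=> j; rewrite qE mulr_ge0 // exprn_ge0 // ltW.
- apply/matrixP => a b; rewrite !ord1 !mxE big1 // => j _.
  rewrite qE; have := X0 j; rewrite le_eqVlt => /predU1P[E|/F_eq ->].
    by rewrite !mxE -XE -E mulr0 mul0r.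
  by rewrite !mulr0.
Qed.
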